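(* Let $X$ be a complex Banach space, let $A$ be a complex function algebra on a regular Hausdorff topological space $\Omega$, and let $A(\Omega,X)\subseteq C_b(\Omega,X)$ be a vector-valued function algebra with base algebra $A$. If the set $\operatorname{SB}(A)'\cap\operatorname{SB}(A)$ is infinite, then $A(\Omega,X)$ has the weak-DD2P.
   Context: $C_b(\Omega)$ (resp. $C_b(\Omega,X)$) is the space of bounded continuous functions from $\Omega$ to $\mathbb{C}$ (resp. to $X$) with the supremum norm. A function algebra on $\Omega$ is a closed subalgebra of $C_b(\Omega)$ that separates the points of $\Omega$. A vector-valued function algebra $A(\Omega,X)$ is a closed subspace of $C_b(\Omega,X)$ such that: (1) the base algebra $A:=\{x^*\circ f: f\in A(\Omega,X),\ x^*\in X^*\}$ is a function algebra on $\Omega$; (2) for every $f\in A$ and $x\in X$, the function $t\mapsto f(t)x$ belongs to $A(\Omega,X)$; (3) for every $f\in A$ and $g\in A(\Omega,X)$, the pointwise product $fg$ belongs to $A(\Omega,X)$. A point $\omega_0\in\Omega$ is a strong boundary point of $A$ if for every open set $U\subseteq\Omega$ containing $\omega_0$ there is $f\in A$ with $f(\omega_0)=1=\|f\|$ and $\sup_{\omega\in\Omega\setminus U}|f(\omega)|<1$; $\operatorname{SB}(A)$ is the set of strong boundary points of $A$, and $\operatorname{SB}(A)'$ is the set of cluster (accumulation) points of $\operatorname{SB}(A)$ in $\Omega$. A Banach space $Z$ with closed unit ball $B_Z$ has the weak-DD2P if for every non-empty relatively weakly open subset $W$ of $B_Z$ there exists $z\in W$ such that $\sup_{y\in V}\|z-y\|=2$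 for every relatively weakly open subset $V$ of $B_Z$ with $z\in V$. *)

(* Defs.v *)
From HB Require Import structures.
From mathcomp Require Import all_boot all_order all_algebra.
From mathcomp Require Import all_classical all_reals all_analysis.
From mathcomp Require Import complex.

Set Implicit Arguments.
Unset Strict Implicit.
Unset Printing Implicit Defensive.

Import Order.TTheory GRing.Theory Num.Theory.
Import numFieldNormedType.Exports.

Local Open Scope classical_set_scope.
Local Open Scope ring_scope.
Local Open Scope complex_scope.

(* Norms of a normedModType over R[i] are elements of R[i]; suprema are taken
   in R, so we use the real-valued version of the norm. *)
Definition rnorm (R : realType) (V : normedModType R[i]) (v : V) : R :=
  complex.Re `|v|.

Section rnorm_theory.
Variables (R : realType) (V : normedModType R[i]).
Implicit Types u v : V.

Lemma rnormE v : (rnorm v)%:C = `|v|.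
Proof. by apply: RRe_real; exact: ger0_real (normr_ge0 v). Qed.

Lemma rnorm_ge0 v : 0 <= rnorm v.
Proof. by rewrite -ler0c rnormE. Qed.

Lemma rnormD u v : rnorm (u + v) <= rnorm u + rnorm v.
Proof. by rewrite -lecR rmorphD/= !rnormE ler_normD. Qed.

Lemma rnormZ (a : R[i]) v : rnorm (a *: v) = complex.Re `|a| * rnorm v.
Proof.
by apply: (@complexI R); rewrite rmorphM/= !rnormE normrZ; congr (_ * _).
Qed.

Lemma rnorm0 : rnorm (0 : V) = 0.
Proof. by rewrite /rnorm normr0. Qed.

Lemma rnorm_eq0 v : rnorm v = 0 -> v = 0.
Proof. by move=> h; apply/eqP; rewrite -normr_eq0 -rnormE h. Qed.

End rnorm_theory.

Section bounded_continuous.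
Variables (R : realType) (T : topologicalType) (V : normedModType R[i]).

Definition bounded_continuous : {pred T -> V} :=
  mem [set f : T -> V | continuous f /\ bounded_fun f].

Record Cb := MkCb { Cb_fun :> T -> V ; Cb_funP : Cb_fun \in bounded_continuous }.

HB.instance Definition _ := [isSub for Cb_fun].
HB.instance Definition _ := [Choice of Cb by <:].

Lemma bounded_funPr (f : T -> V) :
  bounded_fun f <-> exists M : R, forall t, rnorm (f t) <= M.
Proof.
split=> [|[M fM]].
  case=> M [Mreal fM].
  have := fM (M + 1); rewrite ltrDl ltr01 => /(_ isT)/= fM1.
  exists (complex.Re (M + 1)) => t; rewrite -lecR rnormE RRe_real ?fM1//.
  by rewrite realD.
exists M%:C; split; first by rewrite complex_real.
by move=> x Mx t _ /=; rewrite (le_trans _ (ltW Mx))// -rnormE lecR.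
Qed.

Lemma bounded_continuous_submod : submod_closed bounded_continuous.
Proof.
split.
  rewrite inE; split; first exact: cst_continuous.
  by apply/bounded_funPr; exists 0 => t; rewrite rnorm0.
move=> a f g; rewrite !inE => -[cf /bounded_funPr[M fM]].
move=> [cg /bounded_funPr[N gN]]; split.
  move=> t; apply: cvgD; last exact: cg.
  by apply: cvgZr; exact: cf.
apply/bounded_funPr; exists (complex.Re `|a| * M + N) => t.
rewrite (le_trans (rnormD _ _))// lerD// rnormZ ler_wpM2l//.
by rewrite (@rnorm_ge0 R R[i]^o).
Qed.

HB.instance Definition _ := GRing.isSubmodClosed.Build _ _ bounded_continuous
  bounded_continuous_submod.
HB.instance Definition _ := [SubChoice_isSubLmodule of Cb by <:].

Definition Cb_norm (f : Cb) : R[i] := (sup [set rnorm (f t) | t in setT])%:C.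

Lemma Cb_ubound (f : Cb) : has_ubound [set rnorm (f t) | t in setT].
Proof.
have := Cb_funP f; rewrite inE => -[_ /bounded_funPr[M fM]].
by exists M => _ [t _ <-].
Qed.

Lemma Cb_norm_ub (f : Cb) t : `|f t| <= Cb_norm f.
Proof.
by rewrite -rnormE lecR; apply: ub_le_sup; [exact: Cb_ubound|exists t].
Qed.

Lemma Cb_norm_ge0 (f : Cb) : 0 <= Cb_norm f.
Proof.
rewrite ler0c; case: (pselect (exists t : T, True)) => [[t _]|nT].
  apply: le_trans (rnorm_ge0 (f t)) _.
  by apply: ub_le_sup; [exact: Cb_ubound|exists t].
rewrite (_ : [set _ | _ in _] = set0) ?sup0//.
by apply/seteqP; split => // r [t]; case: nT; exists t.
Qed.

Lemma Cb_norm_le (f : Cb) (M : R[i]) :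
  0 <= M -> (forall t, `|f t| <= M) -> Cb_norm f <= M.
Proof.
move=> M0 fM; have Mr : M = (complex.Re M)%:C by rewrite RRe_real// ger0_real.
rewrite Mr lecR; case: (pselect (exists t : T, True)) => [[t _]|nT].
  apply: ge_sup; first by exists (rnorm (f t)), t.
  by move=> _ [s _ <-]; rewrite -lecR rnormE -Mr.
rewrite (_ : [set _ | _ in _] = set0) ?sup0.
  by rewrite -lecR -Mr.
by apply/seteqP; split => // r [t]; case: nT; exists t.
Qed.

Let Cb_normD (f g : Cb) : Cb_norm (f + g) <= Cb_norm f + Cb_norm g.
Proof.
apply: Cb_norm_le => [|t]; first by rewrite addr_ge0 ?Cb_norm_ge0.
by rewrite (le_trans (ler_normD _ _))// lerD ?Cb_norm_ub.
Qed.

Let Cb_normZ_le (a : R[i]) (f : Cb) : Cb_norm (a *: f) <= `|a| * Cb_norm f.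
Proof.
apply: Cb_norm_le => [|t]; first by rewrite mulr_ge0 ?Cb_norm_ge0.
by rewrite normrZ ler_wpM2l ?Cb_norm_ub.
Qed.

Let Cb_normZ (a : R[i]) (f : Cb) : Cb_norm (a *: f) = `|a| * Cb_norm f.
Proof.
apply/eqP; rewrite eq_le Cb_normZ_le/=.
have [->|a0] := eqVneq a 0; first by rewrite normr0 mul0r Cb_norm_ge0.
rewrite -ler_pdivlMl ?normr_gt0// -normfV -{1}[f](scalerK a0).
exact: Cb_normZ_le.
Qed.

Let Cb_norm_eq0 (f : Cb) : Cb_norm f = 0 -> f = 0.
Proof.
move=> f0; apply/val_inj/funext => t; apply/eqP.
by rewrite -normr_le0 -f0 Cb_norm_ub.
Qed.

HB.instance Definition _ :=
  Lmodule_isNormed.Build R[i] Cb Cb_normD Cb_normZ Cb_norm_eq0.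

Lemma Cb_normE (f : Cb) : `|f| = (sup [set rnorm (f t) | t in setT])%:C.
Proof. by []. Qed.

End bounded_continuous.

Section Cb_operations.
Variables (R : realType) (T : topologicalType) (V : normedModType R[i]).

Lemma Cb_cst_subproof (x : V) : cst x \in @bounded_continuous R T V.
Proof.
rewrite inE; split; first exact: cst_continuous.
by apply/bounded_funPr; exists (rnorm x) => t.
Qed.

Definition Cb_cst (x : V) : Cb T V := MkCb (Cb_cst_subproof x).

Lemma Cb_mul_subproof (f : Cb T R[i]^o) (g : Cb T V) :
  (fun t => f t *: g t) \in @bounded_continuous R T V.
Proof.
have := Cb_funP f; rewrite inE => -[cf /bounded_funPr[M fM]].
have := Cb_funP g; rewrite inE => -[cg /bounded_funPr[N gN]].
rewrite inE; split.
  by move=> t; apply: cvgZ; [exact: cf|exact: cg].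
apply/bounded_funPr; exists (M * N) => t.
by rewrite rnormZ ler_pM// ?rnorm_ge0//; [exact: rnorm_ge0 (f t)|exact: fM].
Qed.

Definition Cb_mul (f : Cb T R[i]^o) (g : Cb T V) : Cb T V :=
  MkCb (Cb_mul_subproof f g).

End Cb_operations.
Arguments Cb_cst {R} T {V} x.

Section closed_subspaces.
Variables (R : realType) (V : normedModType R[i]).

Record closedSubspace := ClosedSubspace {
  csub_set :> set V ;
  csub_submod : submod_closed [in csub_set] ;
  csub_closed : closed csub_set
}.

(* A closed subspace with the norm inherited from the ambient space. *)
Variable S : closedSubspace.

Definition csub_pred : {pred V} := mem (csub_set S).

Record csub := Csub { csub_val :> V ; csub_valP : csub_val \in csub_pred }.

HB.instance Definition _ := [isSub for csub_val].
HB.instance Definition _ := [Choice of csub by <:].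
HB.instance Definition _ :=
  GRing.isSubmodClosed.Build _ _ csub_pred (csub_submod S).
HB.instance Definition _ := [SubChoice_isSubLmodule of csub by <:].

Let csub_norm (u : csub) : R[i] := `|csub_val u|.

Let csub_normD u v : csub_norm (u + v) <= csub_norm u + csub_norm v.
Proof. exact: ler_normD. Qed.

Let csub_normZ (a : R[i]) u : csub_norm (a *: u) = `|a| * csub_norm u.
Proof. exact: normrZ. Qed.

Let csub_norm_eq0 u : csub_norm u = 0 -> u = 0.
Proof. by move/normr0_eq0 => h; exact: val_inj. Qed.

HB.instance Definition _ :=
  Lmodule_isNormed.Build R[i] csub csub_normD csub_normZ csub_norm_eq0.

Lemma csub_normE (u : csub) : `|u| = `|csub_val u|.
Proof. by []. Qed.

End closed_subspaces.

Section weak_topology.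
Variables (R : realType) (Z : normedModType R[i]).

Record dual := Dual {
  dual_fun :> {linear Z -> R[i]^o} ;
  dual_continuous : continuous dual_fun
}.

(* The coarsest topology on Z making every element of the dual continuous. *)
Definition weak_topology : Type :=
  sup_topology (fun phi : dual => Topological.class (initial_topology phi)).

HB.instance Definition _ := Topological.on weak_topology.

Definition closed_unit_ball : set Z := [set z | `|z| <= 1].

Definition relatively_weakly_open (W : set Z) : Prop :=
  exists2 O : set weak_topology, open O & W = O `&` closed_unit_ball.

Definition weak_DD2P : Prop :=
  forall W : set Z, relatively_weakly_open W -> W !=set0 ->
    exists2 z, W z &
      forall V : set Z, relatively_weakly_open V -> V z ->
        sup [set rnorm (z - y) | y in V] = 2.

End weak_topology.

Section function_algebras.
Variables (R : realType) (T : topologicalType).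

Definition function_algebra (A : set (Cb T R[i]^o)) : Prop :=
  [/\ submod_closed [in A], closed A,
      forall f g, A f -> A g -> A (Cb_mul f g) &
      forall s t : T, s <> t -> exists2 f, A f & f s <> f t].

Definition strong_boundary_point (A : set (Cb T R[i]^o)) (t : T) : Prop :=
  forall U : set T, open U -> U t ->
    exists f, [/\ A f, f t = 1, `|f| = 1 &
      sup [set rnorm (f s) | s in ~` U] < 1].

Definition SB (A : set (Cb T R[i]^o)) : set T :=
  [set t | strong_boundary_point A t].

Variable V : normedModType R[i].

Definition base_algebra (S : set (Cb T V)) : set (Cb T R[i]^o) :=
  [set g : Cb T R[i]^o | exists2 f, S f & exists phi : dual V, g =1 phi \o f].

Definition vector_valued_function_algebra (S : closedSubspace (Cb T V)) : Prop :=
  [/\ function_algebra (base_algebra S),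
      forall f x, base_algebra S f -> csub_set S (Cb_mul f (Cb_cst T x)) &
      forall f g, base_algebra S f -> csub_set S g -> csub_set S (Cb_mul f g)].

End function_algebras.

(* Main.v *)
Require Import Defs.
From mathcomp Require Import all_boot all_order all_algebra.
From mathcomp Require Import all_classical all_reals all_analysis.
From mathcomp Require Import complex.
From mathcomp Require Import ring lra.
Import Order.TTheory GRing.Theory Num.Theory.
Import numFieldNormedType.Exports.
Local Open Scope classical_set_scope.
Local Open Scope ring_scope.
Local Open Scope complex_scope.

(** A relatively weakly open set is only sensitive to finitely many bounded
    functionals, and a bounded functional is small on most terms of a long family
    [w_1, ..., w_n] all of whose sums with coefficients in the unit disc are
    bounded by a fixed constant ([weak_nbhs_some_translate]). In a space of
    functions such families come for free: take functions bounded by [C], the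
    [j]-th one being at most [1/(n+1)] off the [j]-th member of a family of
    disjoint open sets. An infinite subset of a Hausdorff space has arbitrarily
    many points with disjoint open neighbourhoods. Hence, given infinitely many
    points at which bumps of a prescribed kind exist, concentrated on arbitrarily
    small neighbourhoods up to arbitrarily small errors, one of these bumps can
    be added to [z] without leaving a given weak neighbourhood of [z], up to a
    rescaling into the ball ([weak_bumps]). This is used twice.

    First, given [z0] in [W], bumps [f x] are placed at the points [t] in
    both SB(A)' and SB(A), where [f] in [A] peaks at [t] and [x] is parallel to
    [z0 t] (arbitrary if [z0 t] is zero) with norm [1 - |z0 t|]. Since the value
    at [t] is moved inside the unit ball along a disc ending on the sphere,
    [z0 + f x] has norm at most [1 + eta] and its value at [t] has norm exactly
    [1] ([norming_bump]). Repeating this at the same [t] with geometrically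
    decreasing errors converges to [z] in [W], in the unit ball, with
    [|z t| = 1] ([attain_near]). The value has to be exactly [1] because one
    point [z] must serve all weak neighbourhoods and all errors.

    Second, let [V] be a weak neighbourhood of this [z]. Infinitely many strong
    boundary points [s] near [t] satisfy [|z s| > 1 - eps], since [t] is a
    cluster point of SB(A). At such an [s] the bump is [- h z] where
    [|1 - h| <= 1 + eps], [|h s|] is almost [2] and [h] is small away from [s].
    Such an [h] is [1 - b (f)] up to small errors, with [f] a peak function at
    [s] and [b] the Moebius map [b x = (a - x) / (1 - a x)] of the disc, [a]
    close to [1]: it sends [1] to [-1] and [0] to [a]
    ([reflecting_function]). Then [y = z - h z], rescaled into the ball, lies in
    [V] at distance almost [2] from [z]. *)

(** * Real-valued norms *)

Section scalar_norm.
Context {R : realType}.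
Implicit Types (a b : R[i]) (r s : R).

Lemma rnorm1 : rnorm (1 : R[i]^o) = 1.
Proof. by rewrite /rnorm normr1. Qed.

Lemma rnormC r : rnorm (r%:C : R[i]^o) = `|r|.
Proof.
by apply: (@complexI R); rewrite rnormE normc_def/= expr0n addr0 sqrtr_sqr.
Qed.

Lemma rnormM a b : rnorm (a * b : R[i]^o) = rnorm (a : R[i]^o) * rnorm (b : R[i]^o).
Proof. exact: (@rnormZ R R[i]^o a b). Qed.

Lemma rnormX a n : rnorm (a ^+ n : R[i]^o) = rnorm (a : R[i]^o) ^+ n.
Proof. by elim: n => [|n IH]; rewrite ?expr0 ?rnorm1// !exprS rnormM IH. Qed.

Lemma sqr_rnorm r s : rnorm (r +i* s : R[i]^o) ^+ 2 = r ^+ 2 + s ^+ 2.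
Proof.
apply: (@complexI R); rewrite rmorphXn/= rnormE normc_def/= -rmorphXn/=.
by rewrite sqr_sqrtr// addr_ge0 ?sqr_ge0.
Qed.

Lemma gt0_realC (e : R[i]) : 0 < e -> exists2 r : R, 0 < r & e = r%:C.
Proof.
move=> e0; exists (complex.Re e); last by rewrite RRe_real// gtr0_real.
by move: e0; rewrite ltcE => /= /andP[].
Qed.

Lemma phase a : exists2 c : R[i], rnorm (c : R[i]^o) <= 1 &
  c * a = (rnorm (a : R[i]^o))%:C.
Proof.
have [->|a0] := eqVneq a 0.
  by exists 0; rewrite ?rnorm0 ?mul0r.
exists (`|a| / a); last by rewrite divfK// -rnormE.
rewrite -lecR rnormE normrM normrV ?unitfE// normr_id mulfV//.
by rewrite normr_eq0.
Qed.

End scalar_norm.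

Section vector_norm.
Context {R : realType} {V : normedModType R[i]}.
Implicit Types u v : V.

Lemma rnormN v : rnorm (- v) = rnorm v.
Proof. by rewrite /rnorm normrN. Qed.

Lemma rnormB u v : rnorm (u - v) <= rnorm u + rnorm v.
Proof. by rewrite (le_trans (rnormD _ _))// rnormN. Qed.

Lemma rdistC u v : rnorm (u - v) = rnorm (v - u).
Proof. by rewrite /rnorm distrC. Qed.

Lemma rnormZE (a : R[i]) v : rnorm (a *: v) = rnorm (a : R[i]^o) * rnorm v.
Proof. exact: rnormZ. Qed.

Lemma rnormZr (r : R) v : rnorm (r%:C *: v) = `|r| * rnorm v.
Proof. by rewrite rnormZE rnormC. Qed.

Lemma rnorm_le v (r : R) : (`|v| <= r%:C) = (rnorm v <= r).
Proof. by rewrite -rnormE lecR. Qed.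

Lemma rnorm_lt v (r : R) : (`|v| < r%:C) = (rnorm v < r).
Proof. by rewrite -rnormE ltcR. Qed.

Lemma rnorm_sum (I : Type) (r : seq I) (P : pred I) (F : I -> V) :
  rnorm (\sum_(i <- r | P i) F i) <= \sum_(i <- r | P i) rnorm (F i).
Proof.
apply: (big_ind2 (fun v (x : R) => rnorm v <= x)); first by rewrite rnorm0.
- by move=> v x w y vx wy; rewrite (le_trans (rnormD _ _))// lerD.
- by [].
Qed.

(** Constructions below produce vectors of norm at most [1 + eta]; this puts
    them back into the ball at a cost controlled by [eta]. *)
Lemma rescale_unit_ball v (eta : R) :
  0 <= eta -> rnorm v <= 1 + eta ->
  exists2 u, rnorm u <= 1 & rnorm (u - v) <= eta.
Proof.
move=> e0 ve; have e1 : 0 < 1 + eta by lra.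
have ei : 0 <= (1 + eta)^-1 by rewrite invr_ge0 ltW.
exists ((1 + eta)^-1%:C *: v).
  by rewrite rnormZr ger0_norm// ler_pdivrMl// mulr1.
rewrite rdistC -{1}[v]scale1r -scalerBl -[1]/(1%:C) -rmorphB/= rnormZr.
have -> : 1 - (1 + eta)^-1 = eta / (1 + eta) by field; rewrite gt_eqF.
rewrite ger0_norm ?divr_ge0 ?(ltW e1)// mulrAC ler_pdivrMr//.
by rewrite ler_wpM2l.
Qed.

Lemma polar_decomposition (x v : V) :
  x != 0 -> exists2 u, rnorm u = 1 & v = (rnorm v)%:C *: u.
Proof.
have nz (y : V) : y != 0 -> rnorm y != 0 by apply: contra_neq; exact: rnorm_eq0.
have unit (y : V) : y != 0 -> rnorm ((rnorm y)^-1%:C *: y) = 1.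
  move=> y0; rewrite rnormZr ger0_norm ?mulVf ?nz//.
  by rewrite invr_ge0 rnorm_ge0.
move=> x0; have [->|v0] := eqVneq v 0.
  by exists ((rnorm x)^-1%:C *: x); [exact: unit | rewrite rnorm0 scale0r].
exists ((rnorm v)^-1%:C *: v); first exact: unit.
by rewrite scalerA -rmorphM/= mulfV ?nz// scale1r.
Qed.

End vector_norm.

Lemma cvg_rdist {R : realType} {V : normedModType R[i]} {T : topologicalType}
    (f : T -> V) (t : T) (e : R) :
  {for t, continuous f} -> 0 < e -> \forall s \near t, rnorm (f s - f t) < e.
Proof.
move=> ft e0.
have := @cvgr_dist_lt _ _ _ _ _ f (f t) ft e%:C.
rewrite ltcR => /(_ _ e0); apply: filterS => s; by rewrite -rnorm_lt distrC.
Qed.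

Lemma open_rnorm_gt {R : realType} {V : normedModType R[i]}
    {T : topologicalType} (f : T -> V) (e : R) :
  continuous f -> open [set t | e < rnorm (f t)].
Proof.
move=> cf; rewrite openE => t /= et; rewrite /interior.
have := cvg_rdist _ _ (rnorm (f t) - e) (cf t); rewrite subr_gt0 => /(_ et).
apply: filterS => s /=.
have := rnormB (f s) (f s - f t); rewrite opprB addrCA subrr addr0.
lra.
Qed.

Lemma small_power {R : realType} (r e : R) : 0 <= r < 1 -> 0 < e ->
  exists n, r ^+ n <= e.
Proof.
move=> /andP[r0 r1] e0.
have r1' : `|r| < 1 by rewrite ger0_norm.
have := @cvgr0_norm_le _ _ _ _ _ _ (cvg_expr r1') _ e0.
move=> [N _ /(_ N)]/=; rewrite leqnn => /(_ isT) h; exists N.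
by rewrite (le_trans (ler_norm _))// h.
Qed.

Lemma small_half_power {R : realType} (c e : R) : 0 <= c -> 0 < e ->
  exists n, c * 2^-1 ^+ n < e.
Proof.
move=> c0 e0; have c1 : 0 < c + 1 by rewrite ltr_wpDl.
have [||n ne] := @small_power R 2^-1 (e / (c + 1)).
- by apply/andP; split; lra.
- by rewrite divr_gt0.
exists n; have p0 : 0 < 2^-1 ^+ n :> R by rewrite exprn_gt0.
move: ne; rewrite ler_pdivlMr//; lra.
Qed.

Lemma le_add_half_power {R : realType} (a b c : R) : 0 <= c ->
  (forall n, a <= b + c * 2^-1 ^+ n) -> a <= b.
Proof.
move=> c0 h; apply/ler_addgt0Pr => e e0.
have [n ne] := small_half_power c e c0 e0.
by rewrite (le_trans (h n))// lerD2l ltW.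
Qed.

(** * Weakly open sets and bounded sums *)

Section weak.
Context {R : realType} {Z : normedModType R[i]}.
Implicit Types (z v y : Z) (s : seq (dual Z)).

(** The seminorms attached to finite lists of functionals; a single sum
    replaces a finite conjunction of conditions on a neighbourhood. *)
Definition dual_sum s v : R := \sum_(phi <- s) rnorm (phi v).

Lemma dual_sumD s u v : dual_sum s (u + v) <= dual_sum s u + dual_sum s v.
Proof.
rewrite /dual_sum -big_split/=; apply: ler_sum => phi _.
by rewrite linearD/= rnormD.
Qed.

Lemma dual_sum_ge0 s v : 0 <= dual_sum s v.
Proof. by apply: sumr_ge0 => phi _; exact: rnorm_ge0. Qed.

(** The sets containing a [dual_sum] ball around [z] form a filter, so it is
    enough to compare it with each of the topologies of which the weak
    topology is the supremum. *)
Lemma weak_nbhs_dual_sum (O : set (weak_topology Z)) z : open O -> O z ->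
  exists s e, 0 < e /\ forall y, dual_sum s (y - z) < e -> O y.
Proof.
move=> oO Oz.
pose F : set_system Z :=
  [set A | exists s e, 0 < e /\ forall y, dual_sum s (y - z) < e -> A y].
have FF : Filter F.
  split.
  - by exists [::], 1; split.
  - move=> A B [s [e [e0 sA]]] [s' [e' [e'0 s'B]]].
    exists (s ++ s'), (Num.min e e'); split; first by rewrite lt_min e0.
    move=> y; rewrite /dual_sum big_cat/= -!/(dual_sum _ _) lt_min => /andP[h h'].
    split.
      by apply: sA; apply: le_lt_trans h; rewrite lerDl dual_sum_ge0.
    by apply: s'B; apply: le_lt_trans h'; rewrite lerDr dual_sum_ge0.
  - by move=> A B AB [s [e [e0 sA]]]; exists s, e; split=> // y /sA /AB.
suff : F --> (z : weak_topology Z) by move=> /(_ O); apply; exact: open_nbhs_nbhs.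
apply/cvg_sup => phi A; rewrite /= (@nbhsE (initial_topology phi)) =>
  -[B [[C oC CB] Bz] BA].
have Cz : C (phi z) by move: Bz; rewrite -CB.
have : nbhs (phi z) C by exact: open_nbhs_nbhs.
move=> /nbhs_ballP[e /= /gt0_realC[r r0 ->]] eC.
exists [:: phi], r; split=> // y; rewrite /dual_sum big_seq1 => h.
apply: BA; rewrite -CB; apply: eC.
by rewrite -ball_normE /ball_/= rnorm_lt rdistC -linearB.
Qed.

Lemma dual_bounded (phi : dual Z) :
  exists2 M : R, 0 <= M & forall v, rnorm (phi v) <= M * rnorm v.
Proof.
have := @continuous_linear_bounded _ _ _ 0 phi (@dual_continuous _ _ phi 0).
move=> /linear_boundedP/pinfty_ex_gt0[M /gt0_realC[r r0 ->] h].
exists r; first exact: ltW.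
by move=> v; rewrite -lecR rmorphM/= !rnormE.
Qed.

(** For one functional [phi], coefficients [c j] of modulus at most [1] turn
    each [phi (w j)] into its absolute value, so the sum of these absolute
    values is [phi] of one vector of norm at most [C]. The bound [M] does not
    depend on the number of vectors, which is what makes most terms small. *)
Lemma dual_sum_bound s : exists2 M : R, 0 <= M &
  forall n (w : 'I_n -> Z) (C : R),
    (forall c : 'I_n -> R[i], (forall j, rnorm (c j : R[i]^o) <= 1) ->
      rnorm (\sum_j c j *: w j) <= C) ->
    \sum_j dual_sum s (w j) <= M * C.
Proof.
elim: s => [|phi s [M M0 IH]].
  exists 0 => // n w C _; rewrite mul0r big1// => j _.
  by rewrite /dual_sum big_nil.
have [K K0 phiK] := dual_bounded phi.
exists (K + M); first exact: addr_ge0.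
move=> n w C wC; rewrite mulrDl.
under eq_bigr do rewrite /dual_sum big_cons.
rewrite big_split/= lerD//; last exact: IH.
have /choice[c /all_and2[c1 cw]] : forall j, exists c : R[i],
    rnorm (c : R[i]^o) <= 1 /\ c * phi (w j) = (rnorm (phi (w j)))%:C.
  by move=> j; have [c] := phase (phi (w j)); exists c.
have -> : \sum_j rnorm (phi (w j)) = rnorm (phi (\sum_j c j *: w j)).
  rewrite linear_sum/=; under [in RHS]eq_bigr => i _ do rewrite linearZ/= [_ *: _]cw.
  rewrite -(rmorph_sum (@real_complex R)) rnormC ger0_norm//.
  by apply: sumr_ge0 => j _; exact: rnorm_ge0.
by rewrite (le_trans (phiK _))// ler_wpM2l// wC.
Qed.

(** The bound on one vector is the case of a family of size [1]. *)
Lemma dual_sum_bounded s : exists2 M : R, 0 < M &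
  (forall v, dual_sum s v <= M * rnorm v) /\
  forall n (w : 'I_n -> Z) (C : R), 0 <= C ->
    (forall c : 'I_n -> R[i], (forall j, rnorm (c j : R[i]^o) <= 1) ->
      rnorm (\sum_j c j *: w j) <= C) ->
    \sum_j dual_sum s (w j) <= M * C.
Proof.
have [M M0 h] := dual_sum_bound s.
exists (M + 1); first by rewrite ltr_wpDl.
split=> [v|n w C C0 wC]; last by rewrite (le_trans (h _ _ _ wC))// ler_wpM2r// lerDl.
have := h 1%N (fun=> v) (rnorm v); rewrite big_ord1 => /(_ _)/le_trans-> //.
  by move=> c c1; rewrite big_ord1 rnormZE ler_piMl// rnorm_ge0.
by rewrite ler_wpM2r ?rnorm_ge0// lerDl.
Qed.

(** If every [w j] had [dual_sum] at least [e / 2], the total would exceed the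
    bound independent of [n]. Vectors [y] merely close to [z + w j] are
    allowed so that [z + w j] may first be rescaled into the ball. *)
Lemma weak_nbhs_some_translate (V : set Z) z (C : R) : 0 <= C ->
  relatively_weakly_open V -> V z ->
  exists2 d : R, 0 < d & exists n, forall w : 'I_n -> Z,
    (forall c : 'I_n -> R[i], (forall j, rnorm (c j : R[i]^o) <= 1) ->
      rnorm (\sum_j c j *: w j) <= C) ->
    exists j, forall y, rnorm y <= 1 -> rnorm (y - (z + w j)) <= d -> V y.
Proof.
move=> C0 [U oU ->] [Uz _].
have [s [e [e0 sO]]] := weak_nbhs_dual_sum _ _ oU Uz.
have [M M0 [sM wM]] := dual_sum_bounded s.
exists (e / 2 / M); first by rewrite !divr_gt0.
exists (Num.bound (M * C / (e / 2))) => w wC.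
(* [n] is large enough for [M * C < n * (e / 2)] *)
set n := Num.bound _ in w wC *.
have [j wj] : exists j, dual_sum s (w j) < e / 2.
  apply: contrapT => /forallNP h.
  have : n%:R * (e / 2) <= \sum_j dual_sum s (w j).
    rewrite -[X in X%:R * _]card_ord mulr_natl -sumr_const; apply: ler_sum => j _.
    by rewrite leNgt; apply/negP; exact: h.
  have := wM _ w C C0 wC.
  have : M * C / (e / 2) < n%:R
    by rewrite archi_boundP// divr_ge0// ?mulr_ge0// ltW// divr_gt0.
  rewrite ltr_pdivrMr ?divr_gt0//; lra.
exists j => y y1 yd; split; last by rewrite /closed_unit_ball/= rnorm_le.
apply: sO; have -> : y - z = w j + (y - (z + w j)).
  by rewrite [RHS]addrC opprD addrA subrK.
rewrite (le_lt_trans (dual_sumD _ _ _))//.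
have : dual_sum s (y - (z + w j)) <= e / 2.
  by rewrite (le_trans (sM _))// -ler_pdivlMl// mulrC.
lra.
Qed.
End weak.

(** * Scattered bumps *)

Section Cb_norm.
Context {R : realType} {T : topologicalType} {V : normedModType R[i]}.
Implicit Types (f g : Cb T V).

Lemma Cb_continuous f : continuous f.
Proof. by have := Cb_funP f; rewrite inE => -[]. Qed.

Lemma le_rnorm_Cb f t : rnorm (f t) <= rnorm f.
Proof. by rewrite -lecR !rnormE; exact: Cb_norm_ub. Qed.

Lemma rnorm_Cb_le f (M : R) : 0 <= M -> (forall t, rnorm (f t) <= M) ->
  rnorm f <= M.
Proof.
move=> M0 fM; rewrite -lecR rnormE; apply: Cb_norm_le; first by rewrite lecR.
by move=> t; rewrite rnorm_le.
Qed.

Lemma Cb_sumE (I : Type) (r : seq I) (P : pred I) (F : I -> Cb T V) t :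
  (\sum_(i <- r | P i) F i) t = \sum_(i <- r | P i) F i t.
Proof. exact: (big_morph (fun f : Cb T V => f t) (fun f g => erefl) erefl). Qed.

Lemma csub_sumE (S : closedSubspace (Cb T V)) (I : Type) (r : seq I) (P : pred I)
    (F : I -> csub S) :
  csub_val (\sum_(i <- r | P i) F i) = \sum_(i <- r | P i) csub_val (F i).
Proof. exact: (raddf_sum (val : csub S -> Cb T V)). Qed.
End Cb_norm.

Section csub_evaluation.
Context {R : realType} {T : topologicalType} {V : normedModType R[i]}.
Context {S : closedSubspace (Cb T V)}.
Implicit Types (f g : Cb T V) (z w : csub S).

Lemma CbD f g t : (f + g) t = f t + g t.
Proof. by []. Qed.

Lemma CbN f t : (- f) t = - f t.
Proof. by []. Qed.

Lemma csubD z w t : csub_val (z + w) t = csub_val z t + csub_val w t.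
Proof. by rewrite -CbD -(raddfD (val : csub S -> Cb T V)). Qed.

Lemma csubN z t : csub_val (- z) t = - csub_val z t.
Proof. by rewrite -CbN -(raddfN (val : csub S -> Cb T V)). Qed.

Lemma csubB z w t : csub_val (z - w) t = csub_val z t - csub_val w t.
Proof. by rewrite csubD csubN. Qed.

Lemma le_rnorm_csub z t : rnorm (csub_val z t) <= rnorm z.
Proof. exact: le_rnorm_Cb. Qed.

Lemma rnorm_csubE z : rnorm z = rnorm (csub_val z).
Proof. by []. Qed.

Lemma rnorm_csub_le z (M : R) : 0 <= M -> (forall t, rnorm (csub_val z t) <= M) ->
  rnorm z <= M.
Proof. by move=> M0 h; rewrite rnorm_csubE; exact: rnorm_Cb_le. Qed.

Lemma le_rnorm_eval z w t :
  rnorm (csub_val z t) <= rnorm (csub_val w t) + rnorm (w - z).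
Proof.
rewrite -[csub_val z t](subrK (csub_val w t)) addrC.
by rewrite (le_trans (rnormD _ _))// lerD2l rdistC -csubB le_rnorm_csub.
Qed.

End csub_evaluation.

(** Separate the points pairwise; the neighbourhood of the [j]-th point is the
    interior of a finite intersection of separating sets. *)
Lemma disjoint_open_nbhs (T : topologicalType) (t : nat -> T) (n : nat) :
  hausdorff_space T -> injective t -> exists U : 'I_n -> set T,
    [/\ forall j, open (U j), forall j, U j (t j) &
        forall i j s, U i s -> U j s -> i = j].
Proof.
rewrite open_hausdorff => hT tinj.
have : forall ij : 'I_n * 'I_n, exists AB : set T * set T, ij.1 != ij.2 ->
    [/\ open AB.1, open AB.2, AB.1 (t ij.1), AB.2 (t ij.2) & AB.1 `&` AB.2 = set0].
  move=> [i j]/=; have [_|ij] := eqVneq i j; first by exists (set0, set0).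
  have tij : t i != t j by apply: contra_neq ij => /tinj/val_inj.
  have [[A B] /= [Ai Bj] [oA oB /eqP AB]] := hT _ _ tij.
  by exists (A, B) => _; move: Ai Bj; rewrite !inE.
move=> /choice[AB hAB].
pose W j := [set s | forall i, i != j -> (AB (i, j)).2 s /\ (AB (j, i)).1 s].
exists (fun j => interior (W j)); split.
- by move=> j; exact: open_interior.
- move=> j; apply: filter_forall => i; have [->|ij/=] := eqVneq i j.
    by apply: nearW.
  have [_ oB _ Bj _] := hAB (i, j) ij.
  have ji : j != i by rewrite eq_sym.
  have [oA _ Aj _ _] := hAB (j, i) ji.
  near=> s => /= _; split; near: s; exact: open_nbhs_nbhs.
- move=> i j s /interior_subset Wi /interior_subset Wj.
  apply/eqP; apply: contrapT => /negP ij.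
  have [_ _ _ _ AB0] := hAB (i, j) ij.
  suff : (AB (i, j)).1 s /\ (AB (i, j)).2 s.
    by rewrite -[_ /\ _]/(((AB (i, j)).1 `&` (AB (i, j)).2) s) AB0.
  by split; [apply Wi; rewrite eq_sym | apply Wj].
Unshelve. all: by end_near. Qed.

Lemma injective_sequence {T : Type} (E : set T) : infinite_set E ->
  exists2 t : nat -> T, injective t & forall j, E (t j).
Proof.
move=> /infiniteP/card_leP[f].
exists (fun n => val (f (to_setT n))); last by move=> j; exact: set_valP.
by move=> i j /val_inj/(@inj _ _ _ f); rewrite !inE => /(_ I I)/(congr1 val).
Qed.

Lemma limit_point_infinite (T : topologicalType) (E U : set T) t :
  hausdorff_space T -> limit_point E t -> nbhs t U -> infinite_set (E `&` U).
Proof.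
move=> hT Et tU finEU.
have clF : closed (E `&` U `\ t).
  apply: (accessible_finite_set_closed.1 (hausdorff_accessible hT)).
  exact: finite_setD.
have tF : nbhs t (~` (E `&` U `\ t)).
  by apply: open_nbhs_nbhs; split; [exact: closed_openC | case=> _ /=].
have [y [/eqP yt Ey [Uy]]] := Et _ (filterI tU tF).
by apply; split.
Qed.

Section bumps.
Context {R : realType} {T : topologicalType} {V : normedModType R[i]}.

(** At a given point at most one term is of size [C], because the [U j] are
    disjoint, and the others contribute at most [n / (n + 1)] together. *)
Lemma scattered_sum_le (n : nat) (U : 'I_n -> set T) (w : 'I_n -> Cb T V)
    (C : R) (c : 'I_n -> R[i]) :
  (forall i j s, U i s -> U j s -> i = j) -> 0 <= C ->
  (forall j s, rnorm (w j s) <= C) ->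
  (forall j s, ~ U j s -> rnorm (w j s) <= n.+1%:R^-1) ->
  (forall j, rnorm (c j : R[i]^o) <= 1) ->
  rnorm (\sum_j c j *: w j) <= C + 1.
Proof.
move=> disjU C0 wC wU c1; apply: rnorm_Cb_le => [|s]; first by rewrite addr_ge0.
rewrite Cb_sumE (le_trans (rnorm_sum _ _ _ _))//.
have wle j : rnorm ((c j *: w j) s) <= (if `[< U j s >] then C else 0) + n.+1%:R^-1.
  rewrite [X in rnorm X](_ : _ = c j *: w j s)// rnormZE.
  apply: (@le_trans _ _ (rnorm (w j s))); first by rewrite ler_piMl// rnorm_ge0.
  case: asboolP => [_|/wU]; last by rewrite add0r.
  by rewrite ler_wpDr.
apply: (le_trans (ler_sum _ (fun j _ => wle j))).
rewrite big_split/= lerD//.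
  case: (pselect (exists j, U j s)) => [[j Uj]|/forallNP nU].
    rewrite (bigD1 j)//= big1 ?addr0; first by case: asboolP.
    by move=> i ij; case: asboolP => // Ui; rewrite (disjU _ _ _ Ui Uj) eqxx in ij.
  by rewrite big1// => j _; case: asboolP => // /nU.
by rewrite sumr_const card_ord -[leLHS]mulr_natl ler_pdivrMr ?ltr0n// mul1r ler_nat.
Qed.

(** [P t w] prescribes the kind of bump [w] wanted at [t]. The tolerance [d]
    depends on [W], [z] and [C] only, so [E] and [P] may be chosen after it. *)
Lemma weak_bumps (S : closedSubspace (Cb T V)) (W : set (csub S)) z (C : R) :
  hausdorff_space T -> 0 <= C -> relatively_weakly_open W -> W z ->
  exists2 d : R, 0 < d & forall (E : set T) (P : T -> csub S -> Prop),
    infinite_set E ->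
    (forall t (U : set T) (eta : R), E t -> open U -> U t -> 0 < eta ->
      exists w, [/\ P t w, forall s, rnorm (csub_val w s) <= C &
        forall s, ~ U s -> rnorm (csub_val w s) <= eta]) ->
    exists t w, [/\ E t, P t w & forall y, rnorm y <= 1 ->
      rnorm (y - (z + w)) <= d -> W y].
Proof.
move=> hT C0 oW Wz.
have [d d0 [n dW]] := weak_nbhs_some_translate W z (C + 1) (addr_ge0 C0 ler01) oW Wz.
exists d => // E P /injective_sequence[t tinj tE] bump.
have [U [oU Ut disjU]] := disjoint_open_nbhs T t n hT tinj.
have /choice[w hw] : forall j : 'I_n, exists w, [/\ P (t j) w,
    forall s, rnorm (csub_val w s) <= C &
    forall s, ~ U j s -> rnorm (csub_val w s) <= n.+1%:R^-1].
  by move=> j; apply: bump; rewrite ?invr_gt0 ?ltr0n.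
have [|j Wj] := dW w.
  move=> c c1; rewrite [leLHS](_ : _ = rnorm (\sum_j c j *: csub_val (w j))).
    apply: (scattered_sum_le _ U) => //.
    - by move=> j; have [] := hw j.
    - by move=> j; have [] := hw j.
  rewrite -[LHS]/(rnorm (csub_val (\sum_j c j *: w j))) csub_sumE.
  by congr rnorm; apply: eq_bigr => j _; exact: (linearZ (val : csub S -> Cb T V)).
by exists (t j), (w j); split=> //; have [] := hw j.
Qed.
End bumps.

(** * Peak functions and reflections of the disc *)

Section peak.
Context {R : realType} {T : topologicalType}.
Context (A : set (Cb T R[i]^o)) (hA : function_algebra A).

(** The exponent is shifted because the algebra need not contain the
    constants: [Cb_pow f n] is [f] to the power [n.+1]. *)
Fixpoint Cb_pow (f : Cb T R[i]^o) (n : nat) : Cb T R[i]^o :=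
  if n is m.+1 then Cb_mul f (Cb_pow f m) else f.

Lemma Cb_powE f n t : Cb_pow f n t = f t ^+ n.+1.
Proof.
elim: n => [|n IH]; first by rewrite expr1.
by rewrite exprS -IH.
Qed.

Lemma Cb_pow_in f n : A f -> A (Cb_pow f n).
Proof. by case: hA => _ _ AM _ Af; elim: n => //= n; exact: AM. Qed.

(** High powers of a function given by strong boundariness become uniformly
    small off [U], where its modulus is bounded by a constant below [1]. *)
Lemma peak_function t (U : set T) (eta : R) : strong_boundary_point A t ->
  open U -> U t -> 0 < eta ->
  exists f, [/\ A f, f t = 1, forall s, rnorm (f s) <= 1 &
    forall s, ~ U s -> rnorm (f s) <= eta].
Proof.
move=> At oU Ut eta0.
have [f [Af ft f1 fU]] := At U oU Ut.
have fle1 s : rnorm (f s) <= 1.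
  by rewrite (le_trans (le_rnorm_Cb _ _))// -rnorm_le f1.
set r := Num.max 0 (sup [set rnorm (f s) | s in ~` U]).
have [|n rn] := small_power r eta _ eta0.
  by rewrite le_max lexx/= gt_max ltr01.
have fr s : ~ U s -> rnorm (f s) <= r.
  move=> Us; rewrite le_max; apply/orP; right; apply: ub_le_sup; last by exists s.
  have [M hM] := Cb_ubound f; exists M => _ [s' _ <-].
  by apply: hM; exists s'.
exists (Cb_pow f n); split.
- exact: Cb_pow_in.
- by rewrite Cb_powE ft expr1n.
- by move=> s; rewrite Cb_powE rnormX exprn_ile1// rnorm_ge0.
- move=> s /fr fsr; rewrite Cb_powE rnormX (le_trans _ rn)// exprS.
  rewrite (@le_trans _ _ (rnorm (f s) ^+ n))//.
    by rewrite ler_piMl// exprn_ge0// rnorm_ge0.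
  by rewrite lerXn2r ?nnegrE ?rnorm_ge0 ?(le_trans _ fsr)// rnorm_ge0.
Qed.
End peak.

Section mobius.
Context {R : realType}.
Implicit Types (a : R) (x : R[i]).

(** A polynomial without constant term approximating, uniformly on the closed
    disc, [a - b x] where [b x = (a - x) / (1 - a x)]: since
    [a - b x = (1 - a ^ 2) x / (1 - a x)], expand the geometric series and
    stop after [K] terms. A polynomial can be applied to elements of an
    algebra without unit. *)
Definition mobius_sum a K x : R[i] :=
  \sum_(k < K) ((1 - a ^+ 2) * a ^+ k)%:C * x ^+ k.+1.

Lemma mobius_sumE a K x :
  (1 - a%:C * x) * mobius_sum a K x =
  (1 - a ^+ 2)%:C * x * (1 - (a%:C * x) ^+ K).
Proof.
have -> : mobius_sum a K x = (1 - a ^+ 2)%:C * x * \sum_(k < K) (a%:C * x) ^+ k.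
  rewrite /mobius_sum mulr_sumr; apply: eq_bigr => k _.
  by rewrite rmorphM/= rmorphXn/= exprMn [x ^+ _]exprS; ring.
rewrite mulrCA; congr (_ * _).
by rewrite -[X in X * _]opprB mulNr -subrX1 opprB.
Qed.

(** The Moebius map preserves the disc, as
    [|1 - a x| ^ 2 - |a - x| ^ 2 = (1 - a ^ 2) (1 - |x| ^ 2)]. *)
Lemma mobius_disc a x : 0 <= a <= 1 -> rnorm (x : R[i]^o) <= 1 ->
  rnorm (a%:C - x : R[i]^o) <= rnorm (1 - a%:C * x : R[i]^o).
Proof.
case: x => u v /andP[a0 a1] x1.
have {}x1 : u ^+ 2 + v ^+ 2 <= 1.
  by rewrite -sqr_rnorm -[leRHS](expr1n _ 2) lerXn2r ?nnegrE ?rnorm_ge0.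
rewrite -(@ler_pXn2r _ 2) ?nnegrE ?rnorm_ge0//.
have -> : a%:C - (u +i* v) = (a - u) +i* (- v).
  by apply/eqP; rewrite eq_complex/= sub0r !eqxx.
have -> : 1 - a%:C * (u +i* v) = (1 - a * u) +i* (- (a * v)).
  by apply/eqP; rewrite eq_complex/=; apply/andP; split; apply/eqP; ring.
rewrite !sqr_rnorm.
have : 0 <= (1 - a ^+ 2) * (1 - (u ^+ 2 + v ^+ 2)).
  by rewrite mulr_ge0// subr_ge0// expr_le1.
nra.
Qed.

Lemma mobius_lower a x : 0 <= a <= 1 -> rnorm (x : R[i]^o) <= 1 ->
  1 - a <= rnorm (1 - a%:C * x : R[i]^o).
Proof.
move=> /andP[a0 a1] x1.
have := @rnormD _ _ (1 - a%:C * x : R[i]^o) (a%:C * x).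
rewrite subrK rnorm1 rnormM rnormC ger0_norm// => h.
have : a * rnorm (x : R[i]^o) <= a by rewrite ler_piMr.
lra.
Qed.

(** Multiplied by [1 - a x], the left-hand side becomes [a - x] up to a
    truncation error [(1 - a ^ 2) x (a x) ^ K], and [1 - a <= |1 - a x|]
    absorbs the factor [1 - a] of that error. *)
Lemma mobius_sum_le a K x : 0 <= a < 1 -> rnorm (x : R[i]^o) <= 1 ->
  rnorm (a%:C - mobius_sum a K x : R[i]^o) <= 1 + 2 * a ^+ K.
Proof.
move=> /andP[a0 a1] x1; have a01 : 0 <= a <= 1 by rewrite a0 ltW.
have lo := mobius_lower a x a01 x1.
set m := rnorm (1 - _ : R[i]^o) in lo.
have m0 : 0 < m by rewrite (lt_le_trans _ lo)// subr_gt0.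
rewrite -(ler_pM2l m0) -rnormM mulrBr mobius_sumE.
rewrite (_ : _ - _ = a%:C - x + (1 - a ^+ 2)%:C * x * (a%:C * x) ^+ K); last first.
  by rewrite rmorphB/= rmorphXn/=; ring.
rewrite (le_trans (@rnormD R R[i]^o _ _))//.
have h1 := mobius_disc a x a01 x1.
have aK : 0 <= a ^+ K by rewrite exprn_ge0.
have h2 : rnorm ((1 - a ^+ 2)%:C * x * (a%:C * x) ^+ K : R[i]^o) <= (1 - a ^+ 2) * a ^+ K.
  rewrite !rnormM rnormX rnormM !rnormC [`|a|]ger0_norm//.
  rewrite ger0_norm ?subr_ge0 ?expr_le1 ?(ltW a1)//.
  rewrite -mulrA ler_wpM2l ?subr_ge0 ?expr_le1 ?(ltW a1)//.
  rewrite exprMn mulrCA ler_piMr// mulr_ile1 ?exprn_ile1 ?exprn_ge0 ?rnorm_ge0//.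
have : (1 - a ^+ 2) * a ^+ K <= m * (2 * a ^+ K).
  rewrite mulrA ler_wpM2r//; nra.
rewrite -/m in h1; lra.
Qed.

Lemma mobius_sum1 a K : 0 <= a < 1 ->
  rnorm (mobius_sum a K 1 : R[i]^o) = (1 + a) * (1 - a ^+ K).
Proof.
move=> /andP[a0 a1].
have m0 : 1 - a != 0 by rewrite gt_eqF// subr_gt0.
have := mobius_sumE a K 1; rewrite !mulr1 => /(congr1 (fun x => rnorm (x : R[i]^o))).
rewrite !rnormM -[1 : R[i]]/(1%:C) -rmorphXn -!rmorphB/= !rnormC.
rewrite !ger0_norm ?subr_ge0 ?exprn_ile1 ?(ltW a1)//.
move=> h; apply: (mulfI m0); rewrite h; ring.
Qed.

Lemma mobius_sum_small a K x : 0 <= a < 1 -> rnorm (x : R[i]^o) <= 1 ->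
  rnorm (mobius_sum a K x : R[i]^o) <= 4 * rnorm (x : R[i]^o).
Proof.
move=> /andP[a0 a1] x1; have a01 : 0 <= a <= 1 by rewrite a0 ltW.
have lo := mobius_lower a x a01 x1.
set m := rnorm (1 - _ : R[i]^o) in lo.
have m0 : 0 < m by rewrite (lt_le_trans _ lo)// subr_gt0.
rewrite -(ler_pM2l m0) -rnormM mobius_sumE !rnormM rnormC.
rewrite ger0_norm ?subr_ge0 ?expr_le1 ?(ltW a1)//.
have xK : rnorm (1 - (a%:C * x) ^+ K : R[i]^o) <= 2.
  rewrite (le_trans (@rnormB R R[i]^o _ _))// rnorm1 rnormX rnormM rnormC ger0_norm//.
  rewrite [leRHS](_ : 2 = 1 + 1)// lerD2l.
  by rewrite exprn_ile1// ?mulr_ge0 ?mulr_ile1 ?rnorm_ge0// ltW.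
have x0 : 0 <= rnorm (x : R[i]^o) by exact: rnorm_ge0.
rewrite (le_trans (ler_wpM2l _ xK))// ?mulr_ge0 ?subr_ge0 ?expr_le1 ?(ltW a1)//.
rewrite mulrAC [leRHS]mulrA ler_wpM2r//; nra.
Qed.
End mobius.

Section reflection.
Context {R : realType} {T : topologicalType}.
Context (A : set (Cb T R[i]^o)) (hA : function_algebra A).

(** Multiplication by [1 - h] keeps the unit ball almost invariant, nearly
    reverses the sign of the value at [t] and hardly changes anything off [U]. *)
Lemma reflecting_function t (U : set T) (eps : R) :
  strong_boundary_point A t -> open U -> U t -> 0 < eps ->
  exists h, [/\ A h, forall s, rnorm (1 - h s : R[i]^o) <= 1 + eps,
    2 - eps <= rnorm (h t) & forall s, ~ U s -> rnorm (h s) <= eps].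
Proof.
move=> At oU Ut e0.
have [f [Af ft f1 fU]] :=
  peak_function A hA t U (eps / 4) At oU Ut (divr_gt0 e0 (ltr0Sn _ _)).
(* [e] is both [1 - a] and the truncation error; the cap keeps [a] positive *)
pose e := Num.min (eps / 4) (2^-1).
have e_gt0 : 0 < e by rewrite lt_min divr_gt0//= invr_gt0.
have e_eps : e <= eps / 4 by rewrite ge_min lexx.
have e_half : e <= 2^-1 by rewrite ge_min lexx orbT.
pose a := 1 - e.
have a01 : 0 <= a < 1 by rewrite /a; lra.
have [K aK] := small_power a e a01 e_gt0.
pose h : Cb T R[i]^o := \sum_(k < K) ((1 - a ^+ 2) * a ^+ k)%:C *: Cb_pow f k.
have hE s : h s = mobius_sum a K (f s).
  by rewrite /h Cb_sumE; apply: eq_bigr => k _; rewrite -Cb_powE.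
exists h; split.
- case: (hA) => -[A0 AZ] _ _ _.
  rewrite /h; elim/big_rec: _ => [|k g _ Ag]; first by move: A0; rewrite /= inE.
  have := AZ ((1 - a ^+ 2) * a ^+ k)%:C (Cb_pow f k) g; rewrite /= !inE.
  by apply => //; exact: Cb_pow_in.
- move=> s; rewrite hE.
  rewrite (_ : 1 - _ = (a%:C - mobius_sum a K (f s)) + e%:C); last first.
    by rewrite /a rmorphB/=; ring.
  rewrite (le_trans (@rnormD R R[i]^o _ _))// rnormC.
  have := mobius_sum_le a K (f s) a01 (f1 s).
  have : `|e| = e by rewrite gtr0_norm.
  lra.
- rewrite hE ft mobius_sum1//.
  rewrite /a in aK *; nra.
- move=> s Us; rewrite hE (le_trans (mobius_sum_small a K (f s) a01 (f1 s)))//.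
  have := fU s Us; lra.
Qed.
End reflection.

(** * Geometric convergence and attainment of the norm *)

Section completeness.
Context {R : realType} {T : topologicalType} {X : completeNormedModType R[i]}.

Lemma geometric_ge0 {V : normedModType R[i]} (u : nat -> V) (c : R) :
  (forall n, rnorm (u n.+1 - u n) <= c * 2^-1 ^+ n) -> 0 <= c.
Proof.
by move=> /(_ 0); rewrite expr0 mulr1; apply: le_trans; exact: rnorm_ge0.
Qed.

Lemma geometric_dist {V : normedModType R[i]} (u : nat -> V) (c : R) :
  (forall n, rnorm (u n.+1 - u n) <= c * 2^-1 ^+ n) ->
  forall n m, (n <= m)%N -> rnorm (u m - u n) <= 2 * c * 2^-1 ^+ n.
Proof.
move=> uc n m /subnKC <-.
have c0 := geometric_ge0 _ _ uc.
have : rnorm (u (n + (m - n))%N - u n) <= 2 * c * (2^-1 ^+ n - 2^-1 ^+ (n + (m - n))).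
  elim: (m - n)%N => [|k IH]; first by rewrite addn0 !subrr rnorm0 mulr0.
  rewrite addnS -(subrKA (u (n + k)%N)) (le_trans (rnormD _ _))//.
  have := uc (n + k)%N; rewrite [2^-1 ^+ (n + k).+1]exprS; lra.
have : 0 <= 2 * c * 2^-1 ^+ (n + (m - n)) by rewrite !mulr_ge0// exprn_ge0.
lra.
Qed.

Lemma geometric_cvg (u : nat -> X) (c : R) :
  (forall n, rnorm (u n.+1 - u n) <= c * 2^-1 ^+ n) ->
  exists l, forall n, rnorm (l - u n) <= 2 * c * 2^-1 ^+ n.
Proof.
move=> uc; have ud := geometric_dist u c uc.
have c0 := geometric_ge0 _ _ uc.
have : cvg (u @ \oo).
  apply/cauchy_cvgP; apply: cauchy_exP => e /= /gt0_realC[r r0 ->].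
  have [n nr] := small_half_power (2 * c) r (mulr_ge0 (ler0n _ _) c0) r0.
  exists (u n), n => // m /= nm.
  rewrite -ball_normE /ball_/= rnorm_lt rdistC (le_lt_trans (ud _ _ nm))//.
move=> cu; exists (lim (u @ \oo)) => n.
apply/ler_addgt0Pr => e e0.
have := @cvgr_dist_lt _ _ _ _ _ u (lim (u @ \oo)) cu e%:C.
rewrite ltcR => /(_ _ e0) [N _ hN].
have := hN (maxn N n) (leq_maxl _ _); rewrite /= rnorm_lt => h.
rewrite -(subrKA (u (maxn N n))) (le_trans (rnormD _ _))// [leLHS]addrC lerD ?(ltW h)//.
by rewrite ud// leq_maxr.
Qed.

(** The limit is taken pointwise in [X]; the estimate is uniform in the point,
    which makes the limit continuous and bounded. *)
Lemma Cb_geometric_cvg (g : nat -> Cb T X) (c : R) :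
  (forall n, rnorm (g n.+1 - g n) <= c * 2^-1 ^+ n) ->
  exists l, forall n, rnorm (l - g n) <= 2 * c * 2^-1 ^+ n.
Proof.
move=> gc.
have c0 := geometric_ge0 _ _ gc.
have /choice[l lg] : forall t, exists x, forall n, rnorm (x - g n t) <= 2 * c * 2^-1 ^+ n.
  move=> t; apply: geometric_cvg => n.
  by rewrite (le_trans _ (gc n))//; exact: (le_rnorm_Cb (g n.+1 - g n)).
have lP : l \in @bounded_continuous R T X.
  rewrite inE; split.
    move=> t; apply/(@cvgrPdist_lt _ _ _ (nbhs t)) => e /gt0_realC[r r0 ->].
    have r3 : 0 < r / 3 by rewrite divr_gt0.
    have [n nr] := small_half_power (2 * c) (r / 3) (mulr_ge0 (ler0n _ _) c0) r3.
    have := cvg_rdist (g n) t (r / 3) (Cb_continuous (g n) t) r3.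
    apply: filterS => s gs; rewrite rnorm_lt.
    have -> : l t - l s = (l t - g n t) - (g n s - g n t) - (l s - g n s).
      by rewrite !opprB !subrKA.
    have := lg t n; have := lg s n.
    have := rnormB (l t - g n t - (g n s - g n t)) (l s - g n s).
    have := rnormB (l t - g n t) (g n s - g n t).
    lra.
  apply/bounded_funPr; exists (rnorm (g 0) + 2 * c) => t.
  rewrite -(subrK (g 0 t) (l t)) addrC (le_trans (rnormD _ _))// lerD ?le_rnorm_Cb//.
  by have := lg t 0; rewrite expr0 mulr1.
exists (MkCb lP) => n; apply: rnorm_Cb_le => [|t]; last exact: lg.
by rewrite !mulr_ge0// exprn_ge0.
Qed.

Lemma csub_geometric_cvg (S : closedSubspace (Cb T X)) (g : nat -> csub S) (c : R) :
  (forall n, rnorm (g n.+1 - g n) <= c * 2^-1 ^+ n) ->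
  exists l : csub S, forall n, rnorm (l - g n) <= 2 * c * 2^-1 ^+ n.
Proof.
move=> gc.
have [l lg] := Cb_geometric_cvg (fun n => csub_val (g n)) c gc.
have Sl : csub_set S l.
  apply: (@csub_closed _ _ S l) => B /nbhs_ballP[e /= /gt0_realC[r r0 ->]] eB.
  have c0 := geometric_ge0 _ _ gc.
  have [n nr] := small_half_power (2 * c) r (mulr_ge0 (ler0n _ _) c0) r0.
  exists (csub_val (g n)); split; first by have := csub_valP (g n); rewrite inE.
  apply: eB; rewrite -ball_normE /ball_/= rnorm_lt (le_lt_trans (lg n))//.
by exists (@Csub _ _ S l (mem_set Sl)).
Qed.
End completeness.

Section almost_antipodal.
Context {R : realType} {Z : normedModType R[i]}.
Implicit Types z w y : Z.

(** Used for bumps [w] of norm almost [2]: then [y] is almost antipodal to [z]. *)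
Lemma almost_antipodal z w (e : R) : 0 <= e -> rnorm (z + w) <= 1 + e ->
  exists y, [/\ rnorm y <= 1, rnorm (y - (z + w)) <= e &
    rnorm w - e <= rnorm (z - y)].
Proof.
move=> e0 zw; have [y y1 yd] := rescale_unit_ball (z + w) e e0 zw.
exists y; split => //.
have := rnormD (z - y) (y - (z + w)).
have -> : z - y + (y - (z + w)) = - w by rewrite subrKA opprD addrA subrr add0r.
by rewrite rnormN; lra.
Qed.
End almost_antipodal.

Section attaining.
Context {R : realType} {Z : normedModType R[i]} (N : Z -> R).
Context (Z_geometric_cvg : forall (u : nat -> Z) (c : R),
  (forall n, rnorm (u n.+1 - u n) <= c * 2^-1 ^+ n) ->
  exists l, forall n, rnorm (l - u n) <= 2 * c * 2^-1 ^+ n).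
Context (N_le : forall z, N z <= rnorm z).
Context (N_lipschitz : forall z w, N z <= N w + rnorm (w - z)).
Context (N_bump : forall z (e : R), 0 < e -> rnorm z <= 1 ->
  exists w, [/\ rnorm (z + w) <= 1 + e, N (z + w) = 1 & rnorm w <= 1 - N z]).
Implicit Types z w y : Z.

(** [N] stands for the norm of the value at a fixed point; rescaling the vector
    given by [N_bump] costs at most [e / 2] in norm and in [N]. *)
Lemma halve_defect z (e : R) : 0 < e -> rnorm z <= 1 -> 1 - e <= N z ->
  exists z', [/\ rnorm z' <= 1, 1 - e / 2 <= N z' & rnorm (z' - z) <= 2 * e].
Proof.
move=> e0 z1 zN; have e2 : 0 < e / 2 by rewrite divr_gt0.
have [w [zw zwN w1]] := N_bump z (e / 2) e2 z1.
have [y y1 yd] := rescale_unit_ball (z + w) (e / 2) (ltW e2) zw.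
exists y; split => //; first by have := N_lipschitz (z + w) y; lra.
have -> : y - z = y - (z + w) + w by rewrite opprD addrA subrK.
by have := rnormD (y - (z + w)) w; lra.
Qed.

Lemma attain_from_ball z (d : R) : 0 < d -> rnorm z <= 1 -> 1 - d <= N z ->
  exists z', [/\ rnorm z' <= 1, N z' = 1 & rnorm (z' - z) <= 4 * d].
Proof.
move=> d0 z1 zN.
have /choice[F hF] : forall p : Z * R, exists z',
    0 < p.2 -> rnorm p.1 <= 1 -> 1 - p.2 <= N p.1 ->
    [/\ rnorm z' <= 1, 1 - p.2 / 2 <= N z' & rnorm (z' - p.1) <= 2 * p.2].
  move=> [y e] /=.
  case: (pselect [/\ 0 < e, rnorm y <= 1 & 1 - e <= N y]) => [[e0 y1 yN]|h].
    by have [y' ?] := halve_defect y e e0 y1 yN; exists y'.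
  by exists y => e0 y1 yN; case: h.
pose u := fix u n := if n is m.+1 then F (u m, d * 2^-1 ^+ m) else z.
have dn n : 0 < d * 2^-1 ^+ n by rewrite mulr_gt0// exprn_gt0.
have uP n : rnorm (u n) <= 1 /\ 1 - d * 2^-1 ^+ n <= N (u n).
  elim: n => [|n [IH1 IH2]]; first by rewrite expr0 mulr1.
  have [h1 h2 _] := hF (u n, d * 2^-1 ^+ n) (dn n) IH1 IH2.
  by split => //; rewrite exprSr mulrA.
have ud n : rnorm (u n.+1 - u n) <= 2 * d * 2^-1 ^+ n.
  have [h1 h2] := uP n.
  have [_ _] := hF (u n, d * 2^-1 ^+ n) (dn n) h1 h2.
  by rewrite /= mulrA.
have [l lu] := Z_geometric_cvg u (2 * d) ud.
have l1 : rnorm l <= 1.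
  apply: (le_add_half_power _ _ (2 * (2 * d))); first by rewrite !mulr_ge0// ltW.
  move=> n; have [un _] := uP n.
  have := rnormD (u n) (l - u n); rewrite addrC subrK; have := lu n; lra.
exists l; split => //; last first.
  by have := lu 0; rewrite expr0 mulr1 /= mulrA -natrM.
apply/eqP; rewrite eq_le (le_trans (N_le _))//=.
apply: (le_add_half_power _ _ (5 * d)); first by rewrite mulr_ge0// ltW.
move=> n; have [_ unN] := uP n.
by have := N_lipschitz (u n) l; have := lu n; lra.
Qed.

(** After rescaling [v] its defect is at most [e], and iterating [halve_defect]
    from there moves it by at most [2 e + 2 (e / 2) + 2 (e / 4) + ...]. *)
Lemma attain_near v (e : R) : 0 < e -> rnorm v <= 1 + e -> N v = 1 ->
  exists z, [/\ rnorm z <= 1, N z = 1 & rnorm (z - v) <= 5 * e].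
Proof.
move=> e0 v1 vN.
have [y y1 yd] := rescale_unit_ball v e (ltW e0) v1.
have yN : 1 - e <= N y by have := N_lipschitz v y; lra.
have [z [z1 zN zy]] := attain_from_ball y e e0 y1 yN.
exists z; split => //; rewrite -(subrKA y).
by have := rnormD (z - y) (y - v); lra.
Qed.
End attaining.

(** * Moving the values of a vector-valued function *)

Section vector_valued.
Context {R : realType} {X : completeNormedModType R[i]} {T : topologicalType}.
Context (A : set (Cb T R[i]^o)) (hA : function_algebra A).
Context (S : closedSubspace (Cb T X)).
Context (AS : forall f x, A f -> csub_set S (Cb_mul f (Cb_cst T x))).
Context (X0 : exists x : X, x != 0).
Implicit Types (z w : csub S).

(** Write [z t = r u] with [u] a unit vector and add [f (1 - r) u], where [f]
    peaks at [t]. On the set where [z] is close to [z t] the norm is at most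
    [r + |f| (1 - r) + eta <= 1 + eta]; elsewhere [f] is small. *)
Lemma norming_bump z t (U : set T) (eta : R) : rnorm z <= 1 ->
  strong_boundary_point A t -> open U -> U t -> 0 < eta ->
  exists w, [/\ rnorm (z + w) <= 1 + eta, rnorm (csub_val (z + w) t) = 1,
    rnorm w <= 1 - rnorm (csub_val z t) &
    forall s, ~ U s -> rnorm (csub_val w s) <= eta].
Proof.
move=> z1 At oU Ut eta0; have [x x0] := X0.
have [u u1 zu] := polar_decomposition x (csub_val z t) x0.
set r := rnorm _ in zu; have r0 : 0 <= r by exact: rnorm_ge0.
have r1 : r <= 1 by rewrite (le_trans (le_rnorm_csub _ _)).
pose B := [set s | rnorm (csub_val z s - csub_val z t) < eta].
have tB : nbhs t B by exact: cvg_rdist (Cb_continuous (csub_val z) t) eta0.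
have [f [Af ft f1 fU]] := peak_function A hA t (interior B `&` U) eta At
  (openI (open_interior B) oU) (conj tB Ut) eta0.
pose w : csub S := Csub (mem_set (AS f ((1 - r)%:C *: u) Af)).
have wE s : csub_val w s = f s *: ((1 - r)%:C *: u) by [].
have rw s : rnorm (csub_val w s) = rnorm (f s) * (1 - r).
  by rewrite wE rnormZE rnormZr u1 mulr1 ger0_norm ?subr_ge0.
have fr s : rnorm (f s) * (1 - r) <= rnorm (f s).
  by rewrite ler_piMr ?rnorm_ge0// lerBlDr lerDl.
have f0 s : 0 <= rnorm (f s) by exact: rnorm_ge0.
exists w; split.
- apply: rnorm_csub_le => [|s]; first by rewrite addr_ge0// ltW.
  rewrite csubD (le_trans (rnormD _ _))// rw.
  have [[/interior_subset/= Bs _]|/fU fs] := pselect ((interior B `&` U) s).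
    have := rnormD (csub_val z s - csub_val z t) (csub_val z t); rewrite subrK -/r.
    have : rnorm (f s) * (1 - r) <= 1 - r by rewrite ler_piMl// subr_ge0.
    rewrite /B/= in Bs; lra.
  by have := le_rnorm_csub z s; have := fr s; lra.
- rewrite csubD wE ft scale1r zu -scalerDl -rmorphD/= rnormZr u1 mulr1.
  by rewrite addrC subrK normr1.
- apply: rnorm_csub_le => [|s]; first by rewrite subr_ge0.
  by rewrite rw ler_piMl// subr_ge0.
- move=> s Us; rewrite rw (le_trans (fr s))// fU// => -[_]; exact: Us.
Qed.

Context (AS_mul : forall h g, A h -> csub_set S g -> csub_set S (Cb_mul h g)).

(** The bump is [- h z] with [h] a reflecting function. It is only bounded below
    through its value at [t], so it is used where [|z t|] is close to [1]. *)
Lemma reflecting_bump z t (U : set T) (eta : R) : rnorm z <= 1 ->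
  strong_boundary_point A t -> open U -> U t -> 0 < eta ->
  exists w, [/\ rnorm (z + w) <= 1 + eta,
    (2 - eta) * rnorm (csub_val z t) <= rnorm w,
    forall s, rnorm (csub_val w s) <= 2 + eta &
    forall s, ~ U s -> rnorm (csub_val w s) <= eta].
Proof.
move=> z1 At oU Ut eta0.
have [h [Ah h1 ht hU]] := reflecting_function A hA t U eta At oU Ut eta0.
have zS : csub_set S (csub_val z) := set_mem (csub_valP z).
pose g : csub S := Csub (mem_set (AS_mul h (csub_val z) Ah zS)).
have gE s : csub_val g s = h s *: csub_val z s by [].
have zle s : rnorm (csub_val z s) <= 1 := le_trans (le_rnorm_csub z s) z1.
have hle s : rnorm (csub_val (- g) s) <= rnorm (h s).
  by rewrite csubN rnormN gE rnormZE ler_piMr// rnorm_ge0.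
exists (- g); split.
- apply: rnorm_csub_le => [|s]; first by rewrite addr_ge0// ltW.
  rewrite csubB gE -{1}[csub_val z s]scale1r -scalerBl rnormZE.
  by rewrite (le_trans _ (h1 s))// ler_piMr// rnorm_ge0.
- apply: le_trans (le_rnorm_csub (- g) t); rewrite csubN rnormN gE rnormZE.
  by rewrite ler_wpM2r// rnorm_ge0.
- move=> s; apply: (le_trans (hle s)); have := h1 s.
  have := @rnormB _ R[i]^o 1 (1 - h s); rewrite opprB addrC subrK rnorm1.
  by lra.
- by move=> s /hU; apply: le_trans; exact: hle.
Qed.
End vector_valued.

(** Over the zero space the base algebra only contains the zero function,
    which has no peak. *)
Lemma base_nontrivial {R : realType} {V : normedModType R[i]} {T : topologicalType}
    (S : set (Cb T V)) t :
  strong_boundary_point (base_algebra S) t -> exists x : V, x != 0.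
Proof.
move=> /(_ setT openT I)[f [[g Sg [phi fg]] ft _ _]].
exists (g t); apply/eqP => g0; have := fg t.
by rewrite ft /= g0 linear0 => /eqP; rewrite oner_eq0.
Qed.

Theorem theorem2p14 (R : realType) (X : completeNormedModType R[i])
    (Omega : topologicalType) (regOmega : regular_space Omega)
    (hausOmega : hausdorff_space Omega)
    (A : set (Cb Omega R[i]^o)) (hA : function_algebra A)
    (AX : closedSubspace (Cb Omega X))
    (hAX : vector_valued_function_algebra AX)
    (base : base_algebra AX = A)
    (hinf : infinite_set (limit_point (SB A) `&` SB A)) :
  weak_DD2P (csub AX).
Proof.
have [_ AXcst AXmul] := hAX; rewrite base in AXcst AXmul.
have X0 : exists x : X, x != 0.
  have [t [_ At]] := infinite_setN0 hinf.
  by apply: (@base_nontrivial R X Omega AX t); rewrite base.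
have ball1 (W : set (csub AX)) z : relatively_weakly_open W -> W z -> rnorm z <= 1.
  by case=> U _ -> [_]; rewrite /closed_unit_ball/= rnorm_le.
move=> W oW [z0 Wz0].
have z01 := ball1 W z0 oW Wz0.
have [z [Wz [t [z1 At tE zt]]]] : exists z, W z /\ exists t,
    [/\ rnorm z <= 1, SB A t, limit_point (SB A) t & rnorm (csub_val z t) = 1].
  have [d d0 hW] := weak_bumps AX W z0 1 hausOmega ler01 oW Wz0.
  (* [attain_near] loses a factor [5] *)
  have d5 : 0 < d / 5 by rewrite divr_gt0.
  have [|t [w [[tE At] [zw zwt] Wnear]]] := hW _ (fun t w =>
     rnorm (z0 + w) <= 1 + d / 5 /\ rnorm (csub_val (z0 + w) t) = 1) hinf.
    move=> t U eta [_ At] oU Ut eta0.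
    have m0 : 0 < Num.min eta (d / 5) by rewrite lt_min eta0.
    have [w [h1 h2 h3 h4]] := norming_bump A hA AX AXcst X0 z0 t U _ z01 At oU Ut m0.
    exists w; split; first split => //.
    - by rewrite (le_trans h1)// lerD2l ge_min lexx orbT.
    - move=> s; apply: le_trans (le_rnorm_csub w s) _; apply: le_trans h3 _.
      by rewrite lerBlDr lerDl rnorm_ge0.
    - by move=> s /h4/le_trans->//; rewrite ge_min lexx.
  have bump (z : csub AX) e : 0 < e -> rnorm z <= 1 ->
      exists w, [/\ rnorm (z + w) <= 1 + e,
      rnorm (csub_val (z + w) t) = 1 & rnorm w <= 1 - rnorm (csub_val z t)].
    move=> e0 z1.
    have [v [? ? ? _]] := norming_bump A hA AX AXcst X0 z t setT e z1 At openT I e0.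
    by exists v.
  have [z [z1 zt zd]] := attain_near (fun z : csub AX => rnorm (csub_val z t))
    (csub_geometric_cvg AX) (le_rnorm_csub ^~ t) (fun z w => le_rnorm_eval z w t) bump
    (z0 + w) (d / 5) d5 zw zwt.
  exists z; split; last by exists t.
  by apply: Wnear => //; apply: le_trans zd _; rewrite mulrC divfK.
exists z => // V oV Vz.
have V2 y : V y -> rnorm (z - y) <= 2.
  move=> /(ball1 _ _ oV) y1; rewrite (le_trans (rnormB _ _))//.
  by rewrite [leRHS](_ : 2 = 1 + 1)// lerD.
have ubV : has_ubound [set rnorm (z - y) | y in V].
  by exists 2 => _ [y Vy <-]; exact: V2.
apply/eqP; rewrite eq_le; apply/andP; split.
  by apply: ge_sup; [exists (rnorm (z - z)), z | move=> _ [y Vy <-]; exact: V2].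
apply/ler_addgt0Pr => e e0.
(* the bumps are bounded by [2 + eps <= 3] *)
have [d d0 hV] := weak_bumps AX V z 3 hausOmega (ler0n _ _) oV Vz.
pose eps := Num.min (Num.min (e / 4) d) 1.
have eps0 : 0 < eps by rewrite !lt_min divr_gt0//= d0 ltr01.
have eps_e : eps <= e / 4 by rewrite !ge_min lexx.
have eps_d : eps <= d by rewrite !ge_min lexx orbT.
have eps_1 : eps <= 1 by rewrite !ge_min lexx !orbT.
pose O1 := [set s | 1 - eps < rnorm (csub_val z s)].
have oO1 : open O1 by apply: open_rnorm_gt; exact: Cb_continuous.
have infE : infinite_set (SB A `&` O1).
  apply: limit_point_infinite tE _ => //; apply: open_nbhs_nbhs; split => //.
  by rewrite /O1/= zt ltrBlDr ltrDl.
have [|t' [w [_ [zw wlow] Vnear]]] := hV _ (fun _ w =>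
    rnorm (z + w) <= 1 + eps /\ (2 - eps) * (1 - eps) <= rnorm w) infE.
  move=> s U eta [As O1s] oU Us eta0.
  have m0 : 0 < Num.min eta eps by rewrite lt_min eta0.
  have me : Num.min eta eps <= eps by rewrite ge_min lexx orbT.
  have [w [h1 h2 h3 h4]] := reflecting_bump A hA AX AXmul z s U _ z1 As oU Us m0.
  exists w; split; first split.
  - by apply: le_trans h1 _; rewrite lerD2l.
  - apply: le_trans h2; rewrite ler_pM ?subr_ge0 ?lerB ?(ltW O1s)//.
    by apply: le_trans eps_1 _; rewrite ler1n.
  - move=> x; apply: le_trans (h3 x) _; rewrite [leRHS](_ : 3 = 2 + 1); last first.
      by rewrite -natr1.
    by rewrite lerD2l (le_trans me).
  - by move=> x /h4/le_trans->//; rewrite ge_min lexx.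
have [y [y1 yd zy]] := almost_antipodal z w eps (ltW eps0) zw.
have Vy : V y by apply: Vnear => //; apply: le_trans yd _.
have : rnorm (z - y) <= sup [set rnorm (z - y) | y in V].
  by apply: ub_le_sup => //; exists y.
move: zy wlow eps_e eps0; clear.
move: (rnorm _) (rnorm _) (sup _) => a b c; nra.
Qed.
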